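(* Let $\mathcal{A}$ be a nilpotent associative algebra over a field. Then $\mathcal{A}$ is an almost inner Rickart algebra if and only if $a^2=\mathbf{0}$ for every element $a\in\mathcal{A}$.
   Context: Let $\mathcal{A}$ be an associative algebra (not necessarily with unit) which decomposes, as a linear space, into a direct sum $\mathcal{A}=\mathcal{S}\dot{+}\mathcal{N}$ of a semisimple subalgebra $\mathcal{S}$ and the nilpotent radical $\mathcal{N}$ of $\mathcal{A}$ (each may be $\{\mathbf{0}\}$; if $\mathcal{A}$ is nilpotent then $\mathcal{S}=\{\mathbf{0}\}$ and $\mathcal{N}=\mathcal{A}$). Put $\mathcal{S}^2:=\{a^2: a\in\mathcal{S}\}$ and $\mathcal{N}^2:=\{a^2: a\in\mathcal{N}\}$ (sets of squares, not spans). For nonempty $\mathcal{B}\subseteq\mathcal{A}$ the (inner) quadratic annihilator is ${}^{\perp_q}\mathcal{B}:=\{a\in\mathcal{A}: sas=\mathbf{0}\ \forall s\in\mathcal{B}\}$. The algebra $\mathcal{A}$ is called an almost inner Rickart algebra if for every $x\in\mathcal{A}$ there exists an idempotent $e\in\mathcal{A}$ (possibly $e=\mathbf{0}$) such that ${}^{\perp_q}\{x\}\cap(\mathcal{S}^2\cup\mathcal{N}^2)=e\mathcal{A}e\cap(\mathcal{S}^2\cup\mathcal{N}^2)$. *)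

(* Defs.v *)
From HB Require Import structures.
From mathcomp Require Import all_boot all_algebra.
From mathcomp Require Import boolp classical_sets.

Set Implicit Arguments.
Unset Strict Implicit.
Unset Printing Implicit Defensive.

Import GRing.Theory.
Local Open Scope classical_set_scope.
Local Open Scope ring_scope.

(* MathComp's ring and algebra structures all carry a unit, so algebras that
   need not have one are built on top of semigroups: their product is the
   semigroup product (a * b)%g, while +, 0 and *: are those of the module. *)
HB.mixin Record Lmodule_Semigroup_isAssocAlgebra (F : fieldType) A
    of GRing.Lmodule F A & Semigroup A := {
  amulDl : forall a b c : A, ((a + b)%R * c)%g = (a * c)%g + (b * c)%g;
  amulDr : forall a b c : A, (a * (b + c)%R)%g = (a * b)%g + (a * c)%g;
  amulZl : forall (k : F) (a b : A), ((k *: a)%R * b)%g = k *: (a * b)%g;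
  amulZr : forall (k : F) (a b : A), (a * (k *: b)%R)%g = k *: (a * b)%g
}.

#[short(type="assocAlgebraType")]
HB.structure Definition AssocAlgebra (F : fieldType) :=
  { A of Lmodule_Semigroup_isAssocAlgebra F A &
         GRing.Lmodule F A & Semigroup A }.

Section AlmostInnerRickart.
Variables (F : fieldType) (A : assocAlgebraType F).
Implicit Types (a e s x : A) (B I J S N : set A) (w : seq A).

Definition idempotent_elt e := (e * e)%g = e.

Definition subspace B := GRing.submod_closed (mem B).

Definition subalgebra B :=
  subspace B /\ forall a b, B a -> B b -> B (a * b)%g.

Definition ideal_of B I :=
  [/\ I `<=` B, subspace I &
      forall a b, I a -> B b -> I (a * b)%g /\ I (b * a)%g].

(* There is no empty product without a unit, so words are nonempty, of the
   form a :: w: the condition says that all products of n.+1 elements of B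
   vanish. *)
Definition nilpotent_set B := exists n : nat, forall a w,
  B a -> {in w, forall b, B b} -> size w = n ->
  foldl (fun c d => (c * d)%g) a w = 0.

Definition nilpotent_algebra := nilpotent_set setT.

(* N is the nilpotent radical, i.e. the largest nilpotent two-sided ideal,
   of the subalgebra B. *)
Definition nilpotent_radical B N :=
  [/\ ideal_of B N, nilpotent_set N &
      forall I, ideal_of B I -> nilpotent_set I -> I `<=` N].

Definition semisimple_subalgebra S :=
  subalgebra S /\ nilpotent_radical S [set 0].

Definition direct_sum S N :=
  (forall a, exists s n, [/\ S s, N n & a = s + n]) /\ S `&` N = [set 0].

Definition radical_decomposition S N :=
  [/\ semisimple_subalgebra S, nilpotent_radical setT N & direct_sum S N].

Definition squares B : set A := [set (a * a)%g | a in B].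

Definition quad_annihilator B : set A :=
  [set a | forall s, B s -> (s * a * s)%g = 0].

Definition corner e : set A := [set (e * a * e)%g | a in setT].

(* The notion depends on the chosen decomposition A = S + N. *)
Definition almost_inner_Rickart S N :=
  forall x, exists e, idempotent_elt e /\
    quad_annihilator [set x] `&` (squares S `|` squares N) =
    corner e `&` (squares S `|` squares N).

Lemma amul0l a : (0%R * a)%g = 0 :> A.
Proof. by rewrite -{1}(scale0r (0 : A)) amulZl scale0r. Qed.

Lemma amul0r a : (a * 0%R)%g = 0 :> A.
Proof. by rewrite -{1}(scale0r (0 : A)) amulZr scale0r. Qed.

(* For nilpotent A the convention S = {0}, N = A is a decomposition. *)
Lemma nilpotent_radical_decomposition :
  nilpotent_algebra -> radical_decomposition [set 0] setT.
Proof.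
move=> nilA.
have sub0 : subspace [set 0].
  split=> [|k u v]; first by apply/mem_set.
  by move=> /set_mem -> /set_mem ->; apply/mem_set; rewrite /= scaler0 addr0.
split; last 1 first.
- split=> [a|]; last by rewrite setIT.
  by exists 0, a; rewrite add0r.
- split; first by split=> // a b -> ->; rewrite /= amul0l.
  split; last by move=> I [].
    by split=> // a b -> _; rewrite /= amul0l amul0r.
  by exists 0%N => a [|//] ->.
- split=> //; split=> //; split=> [|k u v _ _]; exact/mem_set.
Qed.

End AlmostInnerRickart.

Arguments nilpotent_algebra {F} A.

(* Main.v *)
Require Import Defs.
From mathcomp Require Import all_boot all_algebra.
From mathcomp Require Import boolp classical_sets.

Local Open Scope ring_scope.

(** A nilpotent algebra has [0] as its only idempotent
    ([nilpotent_idempotent_eq0]), so every corner occurring in the almost inner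
    Rickart condition is [{0}] ([corner0]). The quadratic annihilator of [x = 0]
    is the whole algebra, so the condition at this single [x] says that every
    square of an element of the radical vanishes; and the radical of a nilpotent
    algebra is the algebra itself ([nilpotent_radicalT]). Conversely, if all
    squares vanish, both sides of the condition reduce to [{0}] with [e = 0],
    for every [x]. *)

(** An idempotent equals each of its powers, one of which is zero. *)
Lemma nilpotent_idempotent_eq0 (F : fieldType) (A : assocAlgebraType F)
    (e : A) :
  nilpotent_algebra A -> idempotent_elt e -> e = 0.
Proof.
move=> [n nilA] ee.
rewrite -(nilA e (nseq n e) I (fun _ _ => I) (size_nseq n e)).
by elim: n {nilA} => //= n IHn; rewrite ee.
Qed.

Lemma nilpotent_radicalT (F : fieldType) (A : assocAlgebraType F) (N : set A) :
  nilpotent_algebra A -> nilpotent_radical setT N -> forall a, N a.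
Proof.
move=> nilA [_ _ maxN] a; apply: (maxN setT) => //.
by split=> //; split=> [|k u v _ _]; apply/mem_set.
Qed.

Lemma corner0 (F : fieldType) (A : assocAlgebraType F) :
  corner (0 : A) = [set 0]%classic.
Proof.
apply/seteqP; split=> [_ [a _ <-]|_ ->] /=; first by rewrite amul0r.
by exists 0 => //; rewrite amul0r.
Qed.

Theorem theorem2p3 (F : fieldType) (A : assocAlgebraType F) (S N : set A)
    (decA : radical_decomposition S N) (nilA : nilpotent_algebra A) :
  almost_inner_Rickart S N <-> (forall a : A, (a * a)%g = 0).
Proof.
case: decA => _ radN _; split=> [rickart a|sq0 x].
  have [e [/(nilpotent_idempotent_eq0 F A e nilA) -> /seteqP[sub _]]] := rickart 0.
  have Na : N a by exact: nilpotent_radicalT nilA radN a.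
  have sqa : (squares S `|` squares N)%classic (a * a)%g by right; exists a.
  have [|] := sub (a * a)%g; last by rewrite corner0.
  by split=> // _ ->; rewrite amul0r.
exists 0; split; first exact: amul0r.
have sq_eq0 b : (squares S `|` squares N)%classic b -> b = 0.
  by case=> -[c _ <-]; exact: sq0.
rewrite corner0; apply/seteqP; split=> b [] ann sqb; split=> //.
  exact: sq_eq0.
by move=> s _; rewrite (sq_eq0 b sqb) amul0r amul0l.
Qed.
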